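(* Cut is admissible in each super-Belnap calculus: if $C$ is a super-Belnap calculus and a sequent is derivable from the empty set of premises in $C$ extended by Cut, then it is derivable from the empty set of premises in $C$.
   Context: Formulas are built from atoms using $\wedge,\vee,{-},\top,\bot$; a sequent $\Gamma\vartriangleright\Delta$ is a pair of finite multisets of formulas; it is atomic if all its formulas are atoms. The calculus $G\mathcal{B}$ consists of: introduction rules (from $\Gamma\vartriangleright\Delta,\varphi$ and $\Gamma\vartriangleright\Delta,\psi$ infer $\Gamma\vartriangleright\Delta,\varphi\wedge\psi$; from $\varphi,\psi,\Gamma\vartriangleright\Delta$ infer $\varphi\wedge\psi,\Gamma\vartriangleright\Delta$; from $\varphi,\Gamma\vartriangleright\Delta$ and $\psi,\Gamma\vartriangleright\Delta$ infer $\varphi\vee\psi,\Gamma\vartriangleright\Delta$; from $\Gamma\vartriangleright\Delta,\varphi,\psi$ infer $\Gamma\vartriangleright\Delta,\varphi\vee\psi$; from $\varphi,\Gamma\vartriangleright\Delta$ infer $\Gamma\vartriangleright\Delta,{-}\varphi$; from $\Gamma\vartriangleright\Delta,\varphi$ infer ${-}\varphi,\Gamma\vartriangleright\Delta$; axioms $\emptyset\vartriangleright\top$, $\bot\vartriangleright\emptyset$); elimination rules (the inverses of each of these two-way rules, e.g. from $\Gamma\vartriangleright\Delta,\varphi\wedge\psi$ infer $\Gamma\vartriangleright\Delta,\varphi$ and also $\Gamma\vartriangleright\Delta,\psi$, and from $\varphi\vee\psi,\Gamma\vartriangleright\Delta$ infer $\varphi,\Gamma\vartriangleright\Delta$ and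 also $\psi,\Gamma\vartriangleright\Delta$; plus from $\top,\Gamma\vartriangleright\Delta$ infer $\Gamma\vartriangleright\Delta$ and from $\Gamma\vartriangleright\Delta,\bot$ infer $\Gamma\vartriangleright\Delta$); and Weakening and Contraction on both sides. A structural rule is a rule (possibly with infinitely many premises) whose premises and conclusion are atomic sequents, applied in all its substitution instances. A super-Belnap calculus is $G\mathcal{B}$ extended by an arbitrary set of structural rules; proofs are well-founded labelled trees. Cut: from $\Gamma\vartriangleright\Delta,\varphi$ and $\varphi,\Gamma'\vartriangleright\Delta'$ infer $\Gamma,\Gamma'\vartriangleright\Delta,\Delta'$. *)

(* Defs.v *)
From HB Require Import structures.
From mathcomp Require Export all_boot.
From mathcomp Require Export finmap multiset.
From mathcomp Require Export boolp classical_sets.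

Set Implicit Arguments.
Unset Strict Implicit.
Unset Printing Implicit Defensive.

Local Open Scope mset_scope.
Local Open Scope classical_set_scope.

Inductive formula (A : Type) : Type :=
| Atom of A
| And of formula A & formula A
| Or of formula A & formula A
| Neg of formula A
| Top
| Bot.

Arguments Top {A}.
Arguments Bot {A}.

(* Encoding into generic trees; it only serves to equip formulas with the
   choiceType structure that {mset _} requires. *)
Fixpoint formula_encode (A : Type) (f : formula A) : GenTree.tree A :=
  match f with
  | Atom a => GenTree.Leaf a
  | And g h => GenTree.Node 0 [:: formula_encode g; formula_encode h]
  | Or g h => GenTree.Node 1 [:: formula_encode g; formula_encode h]
  | Neg g => GenTree.Node 2 [:: formula_encode g]
  | Top => GenTree.Node 3 [::]
  | Bot => GenTree.Node 4 [::]
  end.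

Fixpoint formula_decode (A : Type) (t : GenTree.tree A) : option (formula A) :=
  match t with
  | GenTree.Leaf a => Some (Atom a)
  | GenTree.Node 0 [:: t1; t2] =>
      if formula_decode t1 is Some g then
        if formula_decode t2 is Some h then Some (And g h) else None
      else None
  | GenTree.Node 1 [:: t1; t2] =>
      if formula_decode t1 is Some g then
        if formula_decode t2 is Some h then Some (Or g h) else None
      else None
  | GenTree.Node 2 [:: t1] =>
      if formula_decode t1 is Some g then Some (Neg g) else None
  | GenTree.Node 3 [::] => Some Top
  | GenTree.Node 4 [::] => Some Bot
  | _ => None
  end.

Lemma formula_encodeK (A : Type) :
  pcancel (@formula_encode A) (@formula_decode A).
Proof. by elim=> //= [g -> h ->|g -> h ->|g ->]. Qed.

HB.instance Definition _ (A : choiceType) :=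
  Choice.copy (formula A) (pcan_type (@formula_encodeK A)).

Definition is_atom (A : Type) (f : formula A) : bool :=
  if f is Atom _ then true else false.

Fixpoint subst (A : Type) (sigma : A -> formula A) (f : formula A) : formula A :=
  match f with
  | Atom a => sigma a
  | And g h => And (subst sigma g) (subst sigma h)
  | Or g h => Or (subst sigma g) (subst sigma h)
  | Neg g => Neg (subst sigma g)
  | Top => Top
  | Bot => Bot
  end.

Record sequent (A : choiceType) : Type := Sequent {
  ante : {mset formula A};
  succ : {mset formula A} }.

Declare Scope sequent_scope.
Delimit Scope sequent_scope with sequent.
Bind Scope sequent_scope with sequent.
Notation "G ▷ D" := (Sequent G%mset D%mset)
  (at level 70, no associativity) : sequent_scope.
Local Open Scope sequent_scope.

Definition atomic (A : choiceType) (s : sequent A) : bool :=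
  all (@is_atom A) (ante s) && all (@is_atom A) (succ s).

(* Multiplicities add up when sigma identifies formulas. *)
Definition subst_mset (A : choiceType) (sigma : A -> formula A)
    (G : {mset formula A}) : {mset formula A} :=
  seq_mset [seq subst sigma f | f <- enum_mset G].

Definition subst_sequent (A : choiceType) (sigma : A -> formula A)
    (s : sequent A) : sequent A :=
  subst_mset sigma (ante s) ▷ subst_mset sigma (succ s).

(* The set of premises may be infinite. *)
Record rule (A : choiceType) : Type := Rule {
  premises : set (sequent A);
  conclusion : sequent A }.

Definition subst_rule (A : choiceType) (sigma : A -> formula A)
    (r : rule A) : rule A :=
  Rule (subst_sequent sigma @` premises r) (subst_sequent sigma (conclusion r)).

Definition structural (A : choiceType) (r : rule A) : Prop :=
  (forall s, premises r s -> atomic s) /\ atomic (conclusion r).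

Definition instances (A : choiceType) (R : set (rule A)) : set (rule A) :=
  [set r | exists2 r0, R r0 & exists sigma, r = subst_rule sigma r0].

(* C is the set of all instances of the rules of a calculus; X is the set of
   premises from which the sequent is derived. *)
Inductive derivable (A : choiceType) (C : set (rule A)) (X : set (sequent A)) :
    sequent A -> Prop :=
| derivable_premise s : X s -> derivable C X s
| derivable_rule r : C r ->
    (forall s, premises r s -> derivable C X s) ->
    derivable C X (conclusion r).

Inductive GB (A : choiceType) : rule A -> Prop :=
| GB_andR (G D : {mset formula A}) (f g : formula A) :
    GB (Rule [set G ▷ f +` D; G ▷ g +` D] (G ▷ And f g +` D))
| GB_andL (G D : {mset formula A}) (f g : formula A) :
    GB (Rule [set f +` (g +` G) ▷ D] (And f g +` G ▷ D))
| GB_orL (G D : {mset formula A}) (f g : formula A) :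
    GB (Rule [set f +` G ▷ D; g +` G ▷ D] (Or f g +` G ▷ D))
| GB_orR (G D : {mset formula A}) (f g : formula A) :
    GB (Rule [set G ▷ f +` (g +` D)] (G ▷ Or f g +` D))
| GB_negR (G D : {mset formula A}) (f : formula A) :
    GB (Rule [set f +` G ▷ D] (G ▷ Neg f +` D))
| GB_negL (G D : {mset formula A}) (f : formula A) :
    GB (Rule [set G ▷ f +` D] (Neg f +` G ▷ D))
| GB_topR :
    GB (Rule set0 (mset0 ▷ [mset Top]))
| GB_botL :
    GB (Rule set0 ([mset Bot] ▷ mset0))
| GB_andR_elim1 (G D : {mset formula A}) (f g : formula A) :
    GB (Rule [set G ▷ And f g +` D] (G ▷ f +` D))
| GB_andR_elim2 (G D : {mset formula A}) (f g : formula A) :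
    GB (Rule [set G ▷ And f g +` D] (G ▷ g +` D))
| GB_andL_elim (G D : {mset formula A}) (f g : formula A) :
    GB (Rule [set And f g +` G ▷ D] (f +` (g +` G) ▷ D))
| GB_orL_elim1 (G D : {mset formula A}) (f g : formula A) :
    GB (Rule [set Or f g +` G ▷ D] (f +` G ▷ D))
| GB_orL_elim2 (G D : {mset formula A}) (f g : formula A) :
    GB (Rule [set Or f g +` G ▷ D] (g +` G ▷ D))
| GB_orR_elim (G D : {mset formula A}) (f g : formula A) :
    GB (Rule [set G ▷ Or f g +` D] (G ▷ f +` (g +` D)))
| GB_negR_elim (G D : {mset formula A}) (f : formula A) :
    GB (Rule [set G ▷ Neg f +` D] (f +` G ▷ D))
| GB_negL_elim (G D : {mset formula A}) (f : formula A) :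
    GB (Rule [set Neg f +` G ▷ D] (G ▷ f +` D))
| GB_topL_elim (G D : {mset formula A}) :
    GB (Rule [set Top +` G ▷ D] (G ▷ D))
| GB_botR_elim (G D : {mset formula A}) :
    GB (Rule [set G ▷ Bot +` D] (G ▷ D))
| GB_weakL (G D : {mset formula A}) (f : formula A) :
    GB (Rule [set G ▷ D] (f +` G ▷ D))
| GB_weakR (G D : {mset formula A}) (f : formula A) :
    GB (Rule [set G ▷ D] (G ▷ f +` D))
| GB_contrL (G D : {mset formula A}) (f : formula A) :
    GB (Rule [set f +` (f +` G) ▷ D] (f +` G ▷ D))
| GB_contrR (G D : {mset formula A}) (f : formula A) :
    GB (Rule [set G ▷ f +` (f +` D)] (G ▷ f +` D)).

Inductive Cut (A : choiceType) : rule A -> Prop :=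
| Cut_rule (G D G' D' : {mset formula A}) (f : formula A) :
    Cut (Rule [set G ▷ f +` D; f +` G' ▷ D'] (G `+` G' ▷ D `+` D')).

Definition super_Belnap (A : choiceType) (C : set (rule A)) : Prop :=
  exists2 R : set (rule A),
    (forall r, R r -> structural r) & C = @GB A `|` instances R.

(* Main.v *)
(** By the elimination rules, a cut on a compound formula reduces to cuts on its
    immediate subformulas, so only a cut on an atom [p] matters, with premises
    [Γ ▷ Δ, p] and [p, Γ' ▷ Δ'].  Derivability without premises is closed under
    substitution, so putting [⊤] for [p] in the second premise and eliminating
    [⊤] yields [Γ'[⊤/p] ▷ Δ'[⊤/p]], which is then weakened by [Γ] and [Δ].  In
    the presence of the context [Γ, Δ] each occurrence of [⊤] that replaced [p]
    can be turned back into [p]: decompose the formulas by the elimination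
    rules; an atom [p] on the left may be added by weakening, and with [p] on
    the right the whole sequent is a weakening of [Γ ▷ Δ, p]; then rebuild the
    formulas by the introduction rules. *)
Require Import Defs.
From mathcomp Require Import all_boot.
From mathcomp Require Import finmap multiset.
From mathcomp Require Import boolp classical_sets.

Set Implicit Arguments.
Unset Strict Implicit.
Unset Printing Implicit Defensive.

Local Open Scope classical_set_scope.
Local Open Scope mset_scope.
Local Open Scope sequent_scope.

Ltac subset_mset :=
  let x := fresh "x" in
  move=> x; rewrite ?(in_msetD, in_mset1, in_mset0);
  by repeat (case: (_ \in _) || case: (_ == _)); rewrite ?orbT.

Lemma subset_mset1Dr (K : choiceType) (x : K) (G H : {mset K}) :
  {subset G <= H} -> {subset G <= x +` H}.
Proof. by move=> sGH y /sGH yH; rewrite in_mset1D yH orbT. Qed.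

Lemma subset_msetDr (K : choiceType) (G H L : {mset K}) :
  {subset G <= H} -> {subset G <= L `+` H}.
Proof. by move=> sGH y /sGH yH; rewrite in_msetD yH orbT. Qed.

Lemma seq_mset_nil (K : choiceType) : seq_mset [::] = mset0 :> {mset K}.
Proof. by apply/msetP=> x; rewrite mset_seqE mset0E. Qed.

(** Weakening by all of [H] comes first; then each element of [G] is contracted against a copy of it
    in [H]. The abstract [P] lets this serve either side of a sequent. *)
Lemma mset_weaken_contract (K : choiceType) (P : {mset K} -> Prop)
    (G H : {mset K}) :
  (forall x L, P L -> P (x +` L)) ->
  (forall x L, P (x +` (x +` L)) -> P (x +` L)) ->
  {subset G <= H} -> P G -> P H.
Proof.
move=> weakP contrP sGH PG.
have PHG : P (seq_mset H `+` G).
  elim: (enum_mset H) => [|x l IH]; first by rewrite seq_mset_nil mset0D.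
  by rewrite mset_cons -msetDA; apply: weakP.
move: PHG sGH; rewrite seq_mset_id msetDC -[G]seq_mset_id.
elim: (enum_mset G) => [|x l IH]; first by rewrite seq_mset_nil mset0D.
rewrite mset_cons => PxlH sxlH; apply: IH; last first.
  by move=> y yl; apply: sxlH; rewrite in_mset1D yl orbT.
(* Apart from the [x] being removed, a copy remains in [H]; [msetB1K] exposes it for contraction. *)
have xlH : x \in seq_mset l `+` H by rewrite in_msetD sxlH ?orbT ?mset1D1.
by move: PxlH; rewrite -msetDA -(msetB1K xlH); apply: contrP.
Qed.

Lemma subst_comp (A : Type) (sigma tau : A -> formula A) (f : formula A) :
  subst sigma (subst tau f) = subst (subst sigma \o tau) f.
Proof. by elim: f => //= [f -> g ->|f -> g ->|f ->]. Qed.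

Lemma subst_mset1D (A : choiceType) (sigma : A -> formula A) (f : formula A)
    (G : {mset formula A}) :
  subst_mset sigma (f +` G) = subst sigma f +` subst_mset sigma G.
Proof.
rewrite /subst_mset -mset_cons; apply/eq_seq_msetP.
rewrite -[_ :: _]/(map (subst sigma) (f :: enum_mset G)); apply: perm_map.
by apply/eq_seq_msetP; rewrite mset_cons !seq_mset_id.
Qed.

Lemma subst_mset0 (A : choiceType) (sigma : A -> formula A) :
  subst_mset sigma mset0 = mset0.
Proof. by rewrite /subst_mset enum_mset0 seq_mset_nil. Qed.

Lemma subst_mset1 (A : choiceType) (sigma : A -> formula A) (f : formula A) :
  subst_mset sigma [mset f] = [mset subst sigma f].
Proof. by rewrite -[ [mset f] ]msetD0 subst_mset1D subst_mset0 msetD0. Qed.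

Lemma subst_mset_comp (A : choiceType) (sigma tau : A -> formula A)
    (G : {mset formula A}) :
  subst_mset sigma (subst_mset tau G) = subst_mset (subst sigma \o tau) G.
Proof.
rewrite {1}/subst_mset; apply/eq_seq_msetP.
apply: perm_trans (perm_map _ (perm_eq_seq_mset _)) _.
by rewrite -map_comp (eq_map (subst_comp sigma tau)).
Qed.

Lemma subst_sequent_comp (A : choiceType) (sigma tau : A -> formula A)
    (s : sequent A) :
  subst_sequent sigma (subst_sequent tau s) =
  subst_sequent (subst sigma \o tau) s.
Proof. by rewrite /subst_sequent /= !subst_mset_comp. Qed.

Lemma derivable_rule1 (A : choiceType) (C : set (rule A)) (X : set (sequent A))
    (s t : sequent A) :
  C (Rule [set s] t) -> derivable C X s -> derivable C X t.
Proof. by move=> Cr ds; apply: (derivable_rule Cr) => u /= ->. Qed.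

Lemma derivable_rule2 (A : choiceType) (C : set (rule A)) (X : set (sequent A))
    (s s' t : sequent A) :
  C (Rule [set s; s'] t) -> derivable C X s -> derivable C X s' ->
  derivable C X t.
Proof. by move=> Cr ds ds'; apply: (derivable_rule Cr) => u /= [->|->]. Qed.

Lemma GB_subst (A : choiceType) (sigma : A -> formula A) (r : rule A) :
  GB r -> GB (subst_rule sigma r).
Proof.
case=> [G D f g|G D f g|G D f g|G D f g|G D f|G D f|||G D f g|G D f g|G D f g
  |G D f g|G D f g|G D f g|G D f|G D f|G D|G D|G D f|G D f|G D f|G D f];
  rewrite /subst_rule /= ?image_setU ?image_set1 ?image_set0 /subst_sequent /=
    ?subst_mset1D ?subst_mset1 ?subst_mset0 /=.
- exact: GB_andR.
- exact: GB_andL.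
- exact: GB_orL.
- exact: GB_orR.
- exact: GB_negR.
- exact: GB_negL.
- exact: GB_topR.
- exact: GB_botL.
- exact: GB_andR_elim1.
- exact: GB_andR_elim2.
- exact: GB_andL_elim.
- exact: GB_orL_elim1.
- exact: GB_orL_elim2.
- exact: GB_orR_elim.
- exact: GB_negR_elim.
- exact: GB_negL_elim.
- exact: GB_topL_elim.
- exact: GB_botR_elim.
- exact: GB_weakL.
- exact: GB_weakR.
- exact: GB_contrL.
- exact: GB_contrR.
Qed.

(** Substitutions compose, so an instance of an instance comes from the same structural rule. *)
Lemma instances_subst (A : choiceType) (R : set (rule A))
    (sigma : A -> formula A) (r : rule A) :
  instances R r -> instances R (subst_rule sigma r).
Proof.
case=> r0 Rr0 [tau ->]; exists r0 => //; exists (subst sigma \o tau).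
rewrite /subst_rule /= subst_sequent_comp image_comp; congr Rule.
by apply: eq_imagel => s _ /=; exact: subst_sequent_comp.
Qed.

Lemma super_Belnap_subst (A : choiceType) (C : set (rule A))
    (sigma : A -> formula A) (r : rule A) :
  super_Belnap C -> C r -> C (subst_rule sigma r).
Proof.
case=> R _ -> [GBr|Rr]; [left; exact: GB_subst|right; exact: instances_subst].
Qed.

(** The rules are closed under substitution, so it acts on whole derivations; with no premises, no
    leaf changes into a foreign one. *)
Lemma derivable_subst (A : choiceType) (C : set (rule A))
    (sigma : A -> formula A) (s : sequent A) :
  super_Belnap C -> derivable C set0 s ->
  derivable C set0 (subst_sequent sigma s).
Proof.
move=> HC; elim=> // r Cr _ IH.
apply: (derivable_rule (super_Belnap_subst sigma HC Cr)) => _ [t rt <-].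
exact: IH.
Qed.

(** Weakening and contraction make multiplicities irrelevant: only supports need comparing. *)
Lemma derivable_subset (A : choiceType) (C : set (rule A))
    (X : set (sequent A)) (G D G' D' : {mset formula A}) :
  (@GB A `<=` C)%classic -> {subset G <= G'} -> {subset D <= D'} ->
  derivable C X (G ▷ D) -> derivable C X (G' ▷ D').
Proof.
move=> GBC sG sD dGD.
apply: (mset_weaken_contract (P := fun L => derivable C X (G' ▷ L)) _ _ sD).
- by move=> f L; apply: derivable_rule1; exact/GBC/GB_weakR.
- by move=> f L; apply: derivable_rule1; exact/GBC/GB_contrR.
apply: (mset_weaken_contract (P := fun L => derivable C X (L ▷ D)) _ _ sG) => //.
- by move=> f L; apply: derivable_rule1; exact/GBC/GB_weakL.
- by move=> f L; apply: derivable_rule1; exact/GBC/GB_contrL.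
Qed.

Definition subst_top (A : choiceType) (p q : A) : formula A :=
  if q == p then Top else Atom q.

(** One induction treats both sides, since negation moves a formula across. The context varies above
    [G0] and [D0], since restoring one subformula may leave the other in it. *)
Lemma derivable_unsubst_top (A : choiceType) (C : set (rule A))
    (X : set (sequent A)) (p : A) (G0 D0 : {mset formula A}) (f : formula A)
    (G D : {mset formula A}) :
  (@GB A `<=` C)%classic -> derivable C X (G0 ▷ Atom p +` D0) ->
  {subset G0 <= G} -> {subset D0 <= D} ->
  (derivable C X (G ▷ subst (subst_top p) f +` D) ->
   derivable C X (G ▷ f +` D)) /\
  (derivable C X (subst (subst_top p) f +` G ▷ D) ->
   derivable C X (f +` G ▷ D)).
Proof.
move=> GBC d0; elim: f G D => [q|f IHf g IHg|f IHf g IHg|f IHf|//|//] G D sG sD /=.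
- rewrite /subst_top; case: eqP => [->|//]; split=> d.
    apply: derivable_subset d0 => // x; rewrite !in_mset1D.
    by case/orP=> [->//|/sD ->]; rewrite orbT.
  by apply: derivable_rule1 (GBC _ (GB_weakL _ _ _)) _;
    apply: derivable_rule1 d; exact/GBC/GB_topL_elim.
- split=> d.
    apply: derivable_rule2 (GBC _ (GB_andR _ _ _ _)) _ _.
      by apply: (IHf _ _ sG sD).1; apply: derivable_rule1 d; exact/GBC/GB_andR_elim1.
    by apply: (IHg _ _ sG sD).1; apply: derivable_rule1 d; exact/GBC/GB_andR_elim2.
  apply: derivable_rule1 (GBC _ (GB_andL _ _ _ _)) _.
  (* Read forwards, [g] is restored beside the still substituted [f], and then [f] beside [g]. *)
  apply: (IHf (g +` G) D (subset_mset1Dr _ sG) sD).2; rewrite msetDCA.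
  apply: (IHg (_ +` G) D (subset_mset1Dr _ sG) sD).2.
  by rewrite msetDCA; apply: derivable_rule1 d; exact/GBC/GB_andL_elim.
- split=> d.
    apply: derivable_rule1 (GBC _ (GB_orR _ _ _ _)) _.
    apply: (IHf G (g +` D) sG (subset_mset1Dr _ sD)).1; rewrite msetDCA.
    apply: (IHg G (_ +` D) sG (subset_mset1Dr _ sD)).1.
    by rewrite msetDCA; apply: derivable_rule1 d; exact/GBC/GB_orR_elim.
  apply: derivable_rule2 (GBC _ (GB_orL _ _ _ _)) _ _.
    by apply: (IHf _ _ sG sD).2; apply: derivable_rule1 d; exact/GBC/GB_orL_elim1.
  by apply: (IHg _ _ sG sD).2; apply: derivable_rule1 d; exact/GBC/GB_orL_elim2.
split=> d.
  apply: derivable_rule1 (GBC _ (GB_negR _ _ _)) _.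
  by apply: (IHf _ _ sG sD).2; apply: derivable_rule1 d; exact/GBC/GB_negR_elim.
apply: derivable_rule1 (GBC _ (GB_negL _ _ _)) _.
by apply: (IHf _ _ sG sD).1; apply: derivable_rule1 d; exact/GBC/GB_negL_elim.
Qed.

Lemma derivable_unsubst_top_mset (A : choiceType) (C : set (rule A))
    (X : set (sequent A)) (p : A) (G0 D0 G D : {mset formula A}) :
  (@GB A `<=` C)%classic -> derivable C X (G0 ▷ Atom p +` D0) ->
  derivable C X (subst_mset (subst_top p) G `+` G0 ▷
                 subst_mset (subst_top p) D `+` D0) ->
  derivable C X (G `+` G0 ▷ D `+` D0).
Proof.
move=> GBC d0; rewrite /subst_mset -{2}[G]seq_mset_id -{2}[D]seq_mset_id.
(* Formulas are restored one at a time, the others joining the context; hence the arbitrary [G1] and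
   [D1] above [G0] and [D0]. *)
have unsubstL l G1 D1 : {subset G0 <= G1} -> {subset D0 <= D1} ->
    derivable C X (seq_mset (map (subst (subst_top p)) l) `+` G1 ▷ D1) ->
    derivable C X (seq_mset l `+` G1 ▷ D1).
  elim: l G1 => [//|f l IH] G1 sG sD /=; rewrite !mset_cons -!msetDA => d.
  apply: (derivable_unsubst_top _ GBC d0 (subset_msetDr _ sG) sD).2.
  rewrite msetDCA; apply: IH => //; first exact: subset_mset1Dr.
  by rewrite msetDCA.
have unsubstR l G1 D1 : {subset G0 <= G1} -> {subset D0 <= D1} ->
    derivable C X (G1 ▷ seq_mset (map (subst (subst_top p)) l) `+` D1) ->
    derivable C X (G1 ▷ seq_mset l `+` D1).
  elim: l D1 => [//|f l IH] D1 sG sD /=; rewrite !mset_cons -!msetDA => d.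
  apply: (derivable_unsubst_top _ GBC d0 sG (subset_msetDr _ sD)).1.
  rewrite msetDCA; apply: IH => //; first exact: subset_mset1Dr.
  by rewrite msetDCA.
by move=> d; apply: unsubstL => //; [|apply: unsubstR => //];
  exact: subset_msetDr.
Qed.

(** Induction on the cut formula alone suffices: the elimination rules decompose it in both
    premises, whatever their derivations. *)
Lemma derivable_cut (A : choiceType) (C : set (rule A))
    (G D G' D' : {mset formula A}) (f : formula A) :
  super_Belnap C ->
  derivable C set0 (G ▷ f +` D) -> derivable C set0 (f +` G' ▷ D') ->
  derivable C set0 (G `+` G' ▷ D `+` D').
Proof.
move=> HC; have GBC : (@GB A `<=` C)%classic by case: HC => R _ -> r; left.
elim: f G D G' D' => [p|f IHf g IHg|f IHf g IHg|f IHf||] G D G' D' dR dL.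
- rewrite msetDC [X in _ ▷ X]msetDC.
  apply: derivable_unsubst_top_mset => //; first exact: dR.
  (* The contexts [G] and [D] of the first premise come in by weakening. *)
  apply: (derivable_subset (G := subst_mset (subst_top p) G')
    (D := subst_mset (subst_top p) D')) => //; try subset_mset.
  apply: derivable_rule1 (GBC _ (GB_topL_elim _ _)) _.
  have := derivable_subst (subst_top p) HC dL.
  by rewrite /subst_sequent /= subst_mset1D /= {1}/subst_top eqxx.
- have df := derivable_rule1 (GBC _ (GB_andR_elim1 _ _ _ _)) dR.
  have dg := derivable_rule1 (GBC _ (GB_andR_elim2 _ _ _ _)) dR.
  (* The cut on [f] leaves [g] on the left for a cut with [dg]; the doubled [G] and [D] are then
     contracted. *)
  have /(IHf _ _ _ _ df) := derivable_rule1 (GBC _ (GB_andL_elim _ _ _ _)) dL.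
  rewrite msetDCA => /(IHg _ _ _ _ dg); apply: derivable_subset => //; subset_mset.
- have df := derivable_rule1 (GBC _ (GB_orL_elim1 _ _ _ _)) dL.
  have dg := derivable_rule1 (GBC _ (GB_orL_elim2 _ _ _ _)) dL.
  (* Dually, [g] stays on the right, and [G'] and [D'] get doubled. *)
  have /IHf/(_ df) := derivable_rule1 (GBC _ (GB_orR_elim _ _ _ _)) dR.
  rewrite -msetDA => /IHg/(_ dg); apply: derivable_subset => //; subset_mset.
- have dR' := derivable_rule1 (GBC _ (GB_negR_elim _ _ _)) dR.
  have dL' := derivable_rule1 (GBC _ (GB_negL_elim _ _ _)) dL.
  by rewrite msetDC [X in _ ▷ X]msetDC; exact: IHf dL' dR'.
- have := derivable_rule1 (GBC _ (GB_topL_elim _ _)) dL.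
  by apply: derivable_subset => //; subset_mset.
- have := derivable_rule1 (GBC _ (GB_botR_elim _ _)) dR.
  by apply: derivable_subset => //; subset_mset.
Qed.

Local Open Scope classical_set_scope.

Theorem theorem3p11 (A : choiceType) (C : set (rule A)) (HC : super_Belnap C)
    (s : sequent A) :
  derivable (C `|` @Cut A) set0 s -> derivable C set0 s.
Proof.
(* Cuts disappear from the leaves downwards: by induction both premises of a cut are already
   derivable in [C]. *)
elim=> // r [Cr|[G D G' D' f]] _ IH; first exact: (derivable_rule Cr).
by apply: (derivable_cut (f := f) HC); apply: IH; [left|right].
Qed.
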